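(* Assume conditions (C) and (P) hold and that $\chi(0)<0$. Let $\phi$ be a bounded solution of (E) with $\phi(t)\geq 0$ for all $t$. Then either $\liminf_{t\to+\infty}\phi(t)>0$ or $\lim_{t\to+\infty}\phi(t)=0$. Likewise, either $\liminf_{t\to-\infty}\phi(t)>0$ or $\lim_{t\to-\infty}\phi(t)=0$.
   Context: Let $(X,\mu)$ be a finite measure space. Let $K:\mathbb{R}\times X\to[0,\infty)$ be measurable and integrable on $\mathbb{R}\times X$, with $\int_{\mathbb{R}}K(s,\tau)\,ds>0$ for every $\tau\in X$. Let $g:[0,\infty)\times X\to[0,\infty)$ be measurable, with $g(0,\tau)=0$ for all $\tau$, $g(\cdot,\tau)$ continuous for each fixed $\tau$, and such that the derivative $g'(0,\tau)$ of $g(\cdot,\tau)$ at $0$ exists and is positive for each $\tau$. Equation (E) is $\phi(t)=\int_X d\mu(\tau)\int_{\mathbb{R}}K(s,\tau)\,g(\phi(t-s),\tau)\,ds$, $t\in\mathbb{R}$; a solution is a continuous function $\phi:\mathbb{R}\to[0,\infty)$ satisfying (E) for every $t$. The characteristic function is $\chi(z)=1-\int_X\int_{\mathbb{R}}K(s,\tau)g'(0,\tau)e^{-sz}\,ds\,d\mu(\tau)$ for real $z$ where the integral converges. Condition (C): for each $\delta>0$ there is a measurable $C_\delta:X\to[0,\infty)$ with $g(u,\tau)\leq C_\delta(\tau)u$ for $u\in[0,\delta]$, $\tau\in X$, and $\int_X C_\delta(\tau)\left(\int_{\mathbb{R}}K(s,\tau)ds\right)d\mu(\tau)<+\infty$.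 Condition (P): every bounded solution $\phi\geq 0$ of (E) that vanishes at some point is identically zero. *)

(* Defs.v *)
From HB Require Import structures.
From mathcomp Require Import all_boot all_order all_algebra.
From mathcomp Require Import all_classical all_reals all_analysis.
Set Implicit Arguments. Unset Strict Implicit. Unset Printing Implicit Defensive.
Import Order.TTheory GRing.Theory Num.Theory.
Import numFieldNormedType.Exports.
Local Open Scope classical_set_scope.
Local Open Scope ring_scope.

Section Defs.
Context {R : realType} {d : measure_display} {X : measurableType d}.
Variable mu : {finite_measure set X -> \bar R}.
Variable K : R -> X -> R.
Variable g : R -> X -> R.

Definition rhsE (phi : R -> R) (t : R) : \bar R :=
  (\int[mu]_tau (\int[lebesgue_measure]_s (K s tau * g (phi (t - s)) tau)%:E))%E.

Definition is_solution (phi : R -> R) : Prop :=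
  continuous phi /\ (forall t, 0 <= phi t) /\ (forall t, (phi t)%:E = rhsE phi t).

Definition condC : Prop :=
  forall delta : R, 0 < delta ->
    exists C : X -> R,
      measurable_fun setT C /\ (forall tau, 0 <= C tau) /\
      (forall u tau, 0 <= u <= delta -> g u tau <= C tau * u) /\
      (\int[mu]_tau ((C tau)%:E * \int[lebesgue_measure]_s (K s tau)%:E) < +oo)%E.

Definition condP : Prop :=
  forall phi, is_solution phi -> bounded_fun phi ->
    (exists t0, phi t0 = 0) -> forall t, phi t = 0.

(* the integral in chi(0), with g'0 tau the derivative of g(., tau) at 0 *)
Definition chi0_integral (g'0 : X -> R) : \bar R :=
  (\int[mu]_tau (\int[lebesgue_measure]_s (K s tau * g'0 tau)%:E))%E.

End Defs.

(* Main.v *)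
Require Import Defs.
From HB Require Import structures.
From mathcomp Require Import all_boot all_order all_algebra.
From mathcomp Require Import all_classical all_reals all_analysis.
From mathcomp Require Import measurable_realfun ring lra.
Import Order.TTheory GRing.Theory Num.Theory.
Import numFieldNormedType.Exports.
Local Open Scope classical_set_scope.
Local Open Scope ring_scope.

(** If the dichotomy fails at plus or minus infinity, there are delta > 0 and
    intervals [a, b] with phi(a), phi(b) >= delta on which phi has a minimum phi(m_n) -> 0.
    Translates of phi are relatively compact (L^1-continuity of translations makes phi
    uniformly continuous), and their limits are solutions, so by (P) phi is small on longer
    and longer windows around m_n; hence the windows lie inside [a, b], where
    phi >= phi(m_n).  Dividing (E) at m_n by phi(m_n), Fatou's lemma gives
      1 >= liminf int int K(s,tau) g(phi(m_n - s),tau) / phi(m_n)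
        >= int int K(s,tau) g'(0,tau) = 1 - chi(0) > 1. *)

(** * Convergence to zero in the extended reals, and translation invariance of Lebesgue integrals *)

Lemma ge0_cvge0P (R : realType) (u : (\bar R)^nat) : (forall n, 0 <= u n)%E ->
  (u n @[n --> \oo] --> 0%E) <->
  (forall e : R, 0 < e -> \forall n \near \oo, (u n <= e%:E)%E).
Proof.
move=> u0; split=> [/fine_cvgP[ufin ucvg] e e0|H].
  move/cvgr0Pnorm_le : ucvg => /(_ e e0) ue.
  near=> n; rewrite -[u n]fineK; last by near: n.
  by rewrite lee_fin (le_trans (ler_norm _))//; near: n.
apply/fine_cvgP; split.
  near=> n; rewrite ge0_fin_numE//; apply: (@le_lt_trans _ _ 1%:E) (ltry _).
  by near: n; exact: H.
apply/cvgr0Pnorm_le => e e0; near=> n.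
have ue : (u n <= e%:E)%E by near: n; exact: H.
have ufin : u n \is a fin_num by rewrite ge0_fin_numE// (le_lt_trans ue)// ltry.
by rewrite ger0_norm ?fine_ge0// -lee_fin /= fineK.
Unshelve. all: by end_near. Qed.

Lemma ge0_integral_shift (R : realType) (f : R -> \bar R) (a : R) :
  measurable_fun [set: R] f -> (forall x, 0 <= f x)%E ->
  (\int[lebesgue_measure]_x f (x + a)%R = \int[lebesgue_measure]_x f x)%E.
Proof.
move=> mf f0.
pose phi : measurableTypeR R -> measurableTypeR R := fun x => x + a.
have mphi : measurable_fun [set: measurableTypeR R] phi.
  exact: (measurable_funD (@measurable_id _ _ _) (measurable_cst a)).
pose hb := isMeasurableFun.Build _ _ (measurableTypeR R) (measurableTypeR R) phi mphi.
pose phim : {mfun measurableTypeR R >-> measurableTypeR R} := HB.pack phi hb.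
transitivity (\int[pushforward (@lebesgue_measure R) phim]_(x in setT) f x)%E.
  by rewrite ge0_integral_pushforward.
(* The push-forward under translation agrees with Lebesgue measure on the intervals []b, c]], and
   that characterises Lebesgue measure. *)
apply: eq_measure_integral => /= A mA _; apply/esym/lebesgue_measure_unique => //= _ [[b c]] _ <-.
rewrite /pushforward /=.
have -> : phi @^-1` `]b, c]%classic = `]b - a, c - a]%classic.
  by apply/seteqP; split=> x /=; rewrite !in_itv /= /phi ltrBlDr lerBrDr.
by rewrite !lebesgue_measure_itv/= !lte_fin ltrD2r -!EFinB; case: ifP => // _; congr EFin; ring.
Qed.

(** * Continuity of translations in L^1 of the line *)

Section translation_L1.
Context {R : realType}.
Local Notation leb := (@lebesgue_measure R).

Let L1cont (h : nat -> R) (f : R -> R) :=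
  (\int[leb]_s `|(f (s + h n) - f s)%:E|)%E @[n --> \oo] --> 0%E.

Let measurable_shift (f : R -> R) (a : R) : measurable_fun [set: R] f ->
  measurable_fun [set: R] (fun s => f (s + a)).
Proof.
move=> mf.
exact: (measurableT_comp mf (measurable_funD (@measurable_id _ _ _) (measurable_cst a))).
Qed.

(** A three-epsilon argument: translation invariance makes the error of replacing [f] by [p k] the
    same before and after the shift, so one good [k] suffices for all large [n]. *)
Let L1cont_closed (h : nat -> R) (f : R -> R) (p : nat -> R -> R) :
  measurable_fun setT f -> (forall k, measurable_fun setT (p k)) ->
  (forall k, L1cont h (p k)) ->
  (\int[leb]_s `|(f s - p k s)%:E|)%E @[k --> \oo] --> 0%E -> L1cont h f.
Proof.
move=> mf mp cp pf; apply/ge0_cvge0P; first by move=> n; exact: integral_ge0.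
move=> e e0; have e30 : 0 < e / 3 by rewrite divr_gt0.
move/ge0_cvge0P : pf => /(_ (fun n => integral_ge0 _ (fun _ _ => abse_ge0 _)) _ e30).
move=> [k _ /(_ k (leqnn k)) /= pk].
move/ge0_cvge0P : (cp k) => /(_ (fun n => integral_ge0 _ (fun _ _ => abse_ge0 _)) _ e30).
apply: filterS => n pn.
have mfp : measurable_fun [set: R] (fun s => `|(f s - p k s)%:E|%E).
  by apply/measurableT_comp => //; apply/measurable_EFinP/measurable_funB.
have mfps : measurable_fun [set: R] (fun s => `|(f (s + h n) - p k (s + h n))%:E|%E).
  by apply/measurableT_comp => //; apply/measurable_EFinP/measurable_funB; exact: measurable_shift.
have mpp : measurable_fun [set: R] (fun s => `|(p k (s + h n) - p k s)%:E|%E).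
  by apply/measurableT_comp => //; apply/measurable_EFinP/measurable_funB => //;
    exact: measurable_shift.
have mff : measurable_fun [set: R] (fun s => `|(f (s + h n) - f s)%:E|%E).
  by apply/measurableT_comp => //; apply/measurable_EFinP/measurable_funB => //;
    exact: measurable_shift.
have shf : (\int[leb]_s `|(f (s + h n) - p k (s + h n))%:E| =
   \int[leb]_s `|(f s - p k s)%:E|)%E.
  exact: (ge0_integral_shift _ (fun s => `|(f s - p k s)%:E|%E)).
apply: (@le_trans _ _ (\int[leb]_s (`|(f (s + h n) - p k (s + h n))%:E| +
   `|(p k (s + h n) - p k s)%:E| + `|(f s - p k s)%:E|))%E).
  apply: ge0_le_integral => //.
  - by apply: emeasurable_funD => //; exact: emeasurable_funD.
  - move=> x _; rewrite -!EFinD lee_fin.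
    have -> : f (x + h n) - f x = (f (x + h n) - p k (x + h n)) +
      (p k (x + h n) - p k x) - (f x - p k x) by ring.
    by rewrite (le_trans (ler_normB _ _))// lerD2r ler_normD.
rewrite ge0_integralD//; last 2 first.
- by move=> x _; rewrite adde_ge0.
- exact: emeasurable_funD.
rewrite ge0_integralD// shf.
have -> : e = e / 3 + e / 3 + e / 3 by field.
by rewrite !EFinD !leeD.
Qed.

(** Dominated convergence: the cut-off function is bounded with bounded support, and it is
    continuous except possibly at the two ends [A] and [- A]. *)
Let L1cont_truncated_continuous (h : nat -> R) (g : R -> R) (A : R) :
  (forall n, `|h n| <= 1) -> h n @[n --> \oo] --> 0 -> continuous g -> 0 <= A ->
  L1cont h (g \* \1_(`[- A, A])).
Proof.
move=> h1 h0 cg A0; set p := g \* _.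
have mg : measurable_fun [set: R] g by exact: continuous_measurable_fun.
have mp : measurable_fun [set: R] p.
  apply: measurable_funM => //; exact: measurable_indic.
have [B [B0 Bp]] : exists B : R, 0 <= B /\ forall s, `|p s| <= B.
  have cng : {within `[- A, A], continuous (fun x => `|g x|)}.
    apply: continuous_subspaceT => x; apply: (@continuous_comp _ _ _ g Num.norm); first exact: cg.
    exact: norm_continuous.
  have [|c _ cmax] := EVT_max _ cng; first lra.
  exists (`|g c|); split => // s; rewrite /p /= indicE.
  have [sE|] := boolP (s \in _); last by rewrite mulr0 normr0.
  by rewrite mulr1; apply: cmax; rewrite inE in sE.
have pout s : A < `|s| -> p s = 0.
  move=> As; rewrite /p /= indicE memNset ?mulr0//= in_itv /= -ler_norml.
  by apply/negP; rewrite -ltNge.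
have pcont s : s != A -> s != - A -> p (s + h n) @[n --> \oo] --> p s.
  move=> sA sNA.
  have hs : (s + h n) @[n --> \oo] --> s.
    by rewrite -[X in _ --> X]addr0; apply: cvgD => //; exact: cvg_cst.
  have [As|As|As] := ltgtP `|s| A.
  - have : g (s + h n) @[n --> \oo] --> p s.
      rewrite (_ : p s = g s).
        by apply: continuous_cvg => //; exact: cg.
      rewrite /p /= indicE mem_set ?mulr1//= in_itv /= -ler_norml; exact: ltW.
    apply: cvg_trans; apply: near_eq_cvg.
    have : \forall n \near \oo, `|s + h n| < A.
      exact: (cvgr_lt _ (cvg_norm hs)).
    apply: filterS => n sn.
    rewrite /p /= indicE mem_set ?mulr1//= in_itv /= -ler_norml; exact: ltW.
  - rewrite pout//; apply: cvg_near_cst.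
    have : \forall n \near \oo, A < `|s + h n|.
      exact: (cvgr_gt _ (cvg_norm hs)).
    by apply: filterS => n; exact: pout.
  - move: sA sNA; rewrite -As; case: (lerP 0 s) => s0.
      by rewrite ger0_norm// eqxx.
    by rewrite ltr0_norm// opprK eqxx.
pose D n s : \bar R := `|(p (s + h n) - p s)%:E|%E.
(* Since [|h n| <= 1], the shifted support stays in the segment widened by 1, and each of the two
   terms is at most [B]. *)
pose dom s : \bar R := ((2 * B)%:E * (\1_(`[- (A + 1), A + 1]) s)%:E)%E.
have [] := @dominated_convergence _ _ _ leb setT measurableT D (cst 0%E) dom.
- move=> n; apply/measurableT_comp => //; apply/measurable_EFinP/measurable_funB => //.
  exact: measurable_shift.
- exact: measurable_cst.
- exists [set A; - A]; split.
  + by apply: measurableU; exact: measurable_set1.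
  + apply: countable_lebesgue_measure0; apply: finite_set_countable; exact: finite_set2.
  + move=> s /= sD; apply: contrapT => sA; apply: sD => _.
    rewrite /D -(@abse0 R); apply: cvg_abse; apply: cvg_EFin; first exact: nearW.
    rewrite -(subrr (p s)) /comp /=; apply: cvgB; last exact: cvg_cst.
    by apply: pcont; apply/eqP => sA'; apply: sA; [left|right].
- rewrite /dom; apply: integrableZl => //; exact: integrable_indic_itv.
- apply: aeW => s n _; rewrite /D /dom abse_id -EFinM /= lee_fin indicE.
  have [|] := boolP (s \in _).
    by move=> _; rewrite mulr1 (le_trans (ler_normB _ _))// mulrDl !mul1r lerD.
  rewrite notin_setE /= in_itv /= -ler_norml => /negP; rewrite -ltNge => As.
  have hn := h1 n.
  rewrite !pout ?subrr ?normr0 ?mulr0//; first lra.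
  have := lerB_normD s (h n); lra.
move=> _ _; rewrite integral0; exact.
Qed.

(** Two successive uses of L^1-closedness: [f] is cut off to [[-k, k]], and each cut-off is
    approximated in L^1 by continuous functions restricted to the same segment. *)
Lemma integral_translation_cvg0 (h : nat -> R) (f : R -> R) :
  (forall n, `|h n| <= 1) -> h n @[n --> \oo] --> 0 ->
  leb.-integrable setT (EFin \o f) ->
  (\int[leb]_s `|(f (s + h n) - f s)%:E|)%E @[n --> \oo] --> 0%E.
Proof.
move=> h1 h0 fi.
have mf : measurable_fun [set: R] f by apply/measurable_EFinP; exact: measurable_int fi.
have m1 k : measurable_fun [set: R] (\1_(`[- k%:R, k%:R]%classic) : R -> R).
  exact: measurable_indic.
apply: (L1cont_closed _ _ (fun k => f \* \1_(`[- k%:R, k%:R]))) => //.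
- by move=> k; apply: measurable_funM.
- move=> k; set E : set R := `[- k%:R, k%:R]%classic.
  have [|||g [cg gi fg]] := @approximation_continuous_integrable R E f.
  + exact: measurable_itv.
  + by apply: compact_finite_measure; exact: segment_compact.
  + by apply: integrableS fi => //; exact: measurable_itv.
  apply: (L1cont_closed _ _ (fun j => g j \* \1_E)).
  + by apply: measurable_funM => //; exact: m1.
  + move=> j; apply: measurable_funM; last exact: m1.
    apply: continuous_measurable_fun; exact: cg.
  + by move=> j; exact: L1cont_truncated_continuous.
  + rewrite [X in X @ _ --> _](_ : _ = fun j => (\int[leb]_(z in E) `|(f z - g j z)%:E|)%E)//.
    apply/funext => j; apply/esym.
    rewrite integral_mkcond; apply: eq_integral => s _.
    rewrite patchE /= indicE; case: ifP => _; first by rewrite !mulr1.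
    by rewrite !mulr0 subrr normr0.
(* The cut-offs tend to [f] in L^1: at each point the difference is eventually zero, and it is
   dominated by [|f|]. *)
have [] := @dominated_convergence _ _ _ leb setT measurableT
  (fun k s => `|(f s - (f \* \1_(`[- k%:R, k%:R])) s)%:E|%E) (cst 0%E) (fun s => `|(f s)%:E|%E).
- move=> n; apply/measurableT_comp => //; apply/measurable_EFinP/measurable_funB => //.
  by apply: measurable_funM => //; exact: m1.
- exact: measurable_cst.
- apply: aeW => s _; apply: cvg_near_cst.
  near=> k; rewrite /= indicE mem_set ?mulr1 ?subrr ?normr0//= in_itv /= -ler_norml.
  by near: k; exact: nbhs_infty_ger.
- exact: integrable_abse.
- apply: aeW => s n _; rewrite /= normr_id lee_fin indicE.
  by case: (_ \in _); rewrite ?mulr1 ?mulr0 ?subrr ?normr0 ?subr0.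
move=> _ _; rewrite integral0; exact.
Unshelve. all: by end_near. Qed.

End translation_L1.

(** * Translations in the first variable on the product space *)

Section product_translation.
Context {R : realType} {d : measure_display} {X : measurableType d}.
Variable mu : {sigma_finite_measure set X -> \bar R}.
Local Notation leb := (@lebesgue_measure R).
Local Notation P := (leb \x mu)%E.

Lemma measurable_prod_shift (W : R * X -> R) (a : R) :
  measurable_fun setT W -> measurable_fun setT (fun p : R * X => W (p.1 + a, p.2)).
Proof.
move=> mW.
apply: (measurableT_comp mW (measurable_fun_pair _ measurable_snd)).
exact: (measurable_funD measurable_fst (measurable_cst a)).
Qed.

Lemma ge0_integral_prod_shift (f : R * X -> \bar R) (a : R) :
  measurable_fun setT f -> (forall p, 0 <= f p)%E ->
  (\int[P]_p f (p.1 + a, p.2)%R = \int[P]_p f p)%E.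
Proof.
move=> mf f0.
have mfa : measurable_fun setT (fun p : R * X => f (p.1 + a, p.2)).
  apply: (measurableT_comp mf (measurable_fun_pair _ measurable_snd)).
  exact: (measurable_funD measurable_fst (measurable_cst a)).
rewrite (@fubini_tonelli2 _ _ _ _ _ leb mu _ mfa (fun=> f0 _)).
rewrite (@fubini_tonelli2 _ _ _ _ _ leb mu _ mf f0).
apply: eq_integral => tau _; apply: (ge0_integral_shift _ (fun s => f (s, tau))) => //.
exact: (measurableT_comp mf (measurable_pair2 _)).
Qed.

(** By Fubini almost every section of [W] is integrable, so the result on the line applies to it;
    dominated convergence in [tau] then integrates these limits. *)
Lemma integral_prod_translation_cvg0 (h : nat -> R) (W : R * X -> R) :
  (forall n, `|h n| <= 1) -> h n @[n --> \oo] --> 0 ->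
  P.-integrable setT (EFin \o W) ->
  (\int[P]_p `|(W (p.1 + h n, p.2) - W p)%:E|)%E @[n --> \oo] --> 0%E.
Proof.
move=> h1 h0 iW.
have mW : measurable_fun setT W by apply/measurable_EFinP; exact: measurable_int iW.
pose F n (p : R * X) : \bar R := `|(W (p.1 + h n, p.2) - W p)%:E|%E.
have mF n : measurable_fun setT (F n).
  apply/measurableT_comp => //; apply/measurable_EFinP/measurable_funB => //.
  exact: measurable_prod_shift.
have F0 n p : (0 <= F n p)%E by exact: abse_ge0.
have mN : measurable_fun setT (fun p : R * X => `|(W p)%:E|%E).
  by apply/measurableT_comp => //; apply/measurable_EFinP.
have N0 (p : R * X) : (0 <= `|(W p)%:E|)%E by exact: abse_ge0.
have [] := @dominated_convergence _ _ _ mu setT measurableT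
  (fun n => fubini_G leb (F n)) (cst 0%E)
  (fun tau => 2%:E * fubini_G leb (fun p : R * X => `|(W p)%:E|) tau)%E.
- by move=> n; exact: (@measurable_fun_fubini_tonelli_G _ _ _ _ _ leb _ (mF n) (F0 n)).
- exact: measurable_cst.
- apply: filterS (ae_integrable2 iW) => tau iWtau _.
  exact: (integral_translation_cvg0 _ (fun s => W (s, tau))).
- apply: integrableZl => //; apply/integrableP; split.
    exact: (@measurable_fun_fubini_tonelli_G _ _ _ _ _ leb _ mN N0).
  under eq_integral do rewrite gee0_abs ?integral_ge0//.
  rewrite -fubini_tonelli2//.
  by have /integrableP[] := iW.
- apply: filterS (ae_integrable2 iW) => tau iWtau n _.
  have mWtau : measurable_fun [set: R] (fun s => W (s, tau)).
    by apply/measurable_EFinP; exact: measurable_int iWtau.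
  have mWs : measurable_fun [set: R] (fun s => `|(W (s + h n, tau))%:E|%E).
    apply/measurableT_comp => //; apply/measurable_EFinP.
    exact: (measurableT_comp mWtau (measurable_funD (@measurable_id _ _ _) (measurable_cst _))).
  have mWa : measurable_fun [set: R] (fun s => `|(W (s, tau))%:E|%E).
    by apply/measurableT_comp => //; apply/measurable_EFinP.
  rewrite gee0_abs; last exact: integral_ge0.
  (* By shift invariance the bound is the integral of [|W|] at the shifted point plus [|W|] at the
     original one, which reduces the claim to the triangle inequality under the integral. *)
  have -> : (2%:E * fubini_G leb (fun p : R * X => `|(W p)%:E|) tau =
     \int[leb]_s (`|(W (s + h n, tau))%:E| + `|(W (s, tau))%:E|))%E.
    rewrite ge0_integralD//.
    rewrite (ge0_integral_shift _ (fun s => `|(W (s, tau))%:E|%E))//.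
    by rewrite mule_natl mule2n.
  apply: ge0_le_integral => //.
  + exact: (measurableT_comp (mF n) (measurable_pair2 _)).
  + exact: emeasurable_funD.
  + by move=> s _; rewrite -EFinD lee_fin ler_normB.
move=> _ _; rewrite integral0.
rewrite [X in _ -> X @ _ --> _](_ : _ = fun n => (\int[mu]_tau fubini_G leb (F n) tau)%E)//.
by apply/funext => n; exact: (@fubini_tonelli2 _ _ _ _ _ leb mu _ (mF n) (F0 n)).
Qed.

End product_translation.

(** * Relative compactness of translates *)

(** An Ascoli argument: Tychonoff's theorem in the product of copies of [[0, M]] gives a cluster
    point, and the common modulus of continuity turns it into a pointwise limit. The indices need
    only satisfy [n <= k n]; monotonicity is not claimed. *)
Lemma translates_cluster (R : realType) (phi : R -> R) (M : R) (t : nat -> R) :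
  (forall x, 0 <= phi x <= M) ->
  (forall e, 0 < e -> exists2 r, 0 < r & forall x y, `|x - y| < r -> `|phi x - phi y| < e) ->
  exists (k : nat -> nat) (psi : R -> R),
    [/\ forall n, (n <= k n)%N, continuous psi &
        forall x, phi (t (k n) + x) @[n --> \oo] --> psi x].
Proof.
move=> phi01 uc.
have cpt := @tychonoff R (fun _ => R) (fun _ => `[0, M]%classic) (fun _ => @segment_compact _ _ _).
pose u : nat -> prod_topology (fun _ : R => R) := fun n x => phi (t n + x).
have [|psi [_ clpsi]] := cpt (u @ \oo) _.
  by exists 0%N => // n _ i; rewrite /= in_itv /=; exact: phi01.
(* A cluster point in the product topology only gives closeness on finitely many points;
   equicontinuity upgrades closeness on an enumeration of the rationals. *)
pose q (j : nat) : R := ratr (odflt 0 (unpickle j : option rat)).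
have nbh1 x e : 0 < e -> nbhs psi [set f : prod_topology (fun _ : R => R) | `|f x - psi x| < e].
  move=> e0; rewrite (_ : [set f | _] = proj x @^-1` (ball (psi x) e)).
    exact: (@proj_continuous R (fun _ => R) x psi _ (nbhsx_ballx _ _ e0)).
  by apply/funext => f; rewrite /= /ball /= distrC.
have nbhk k e : 0 < e -> nbhs psi [set f : prod_topology (fun _ : R => R) |
    forall j, (j < k)%N -> `|f (q j) - psi (q j)| < e].
  move=> e0; elim: k => [|k IH].
    by rewrite (_ : [set f | _] = setT); [exact: filterT|exact/seteqP].
  apply: (filterS _ (filterI IH (nbh1 (q k) e e0))) => f [fk fqk] j.
  by rewrite ltnS leq_eqVlt => /predU1P[->//|]; exact: fk.
(* A cluster point inherits the modulus: some translate is within [e / 3] of [psi] at both [x] and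
   [y]. *)
have psiuc e : 0 < e -> exists2 r, 0 < r & forall x y, `|x - y| < r -> `|psi x - psi y| < e.
  move=> e0; have e30 : 0 < e / 3 by rewrite divr_gt0.
  have [r r0 rP] := uc _ e30; exists r => // x y.
  have uT : (u @ \oo) (range u) by exists 0%N => // n _; exists n.
  have := clpsi _ _ uT (filterI (nbh1 x _ e30) (nbh1 y _ e30)).
  move=> [_ [[n _ <-] [ux uy]]] xyr.
  have xyn : `|u n x - u n y| < e / 3.
    by apply: rP; rewrite (_ : _ - _ = x - y)//; ring.
  rewrite (_ : psi x - psi y = - (u n x - psi x) + (u n x - u n y) + (u n y - psi y)); last by ring.
  rewrite (le_lt_trans (ler_normD _ _))// (_ : e = e / 3 + e / 3 + e / 3); last by field.
  rewrite ltrD// (le_lt_trans (ler_normD _ _))// normrN ltrD//.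
(* Diagonal choice: the [n]-th translate is within [1 / (n + 1)] of [psi] at the first [n] points of
   the enumeration. *)
have /choice[k kP] : forall n, exists m, (n <= m)%N /\
    forall j, (j < n)%N -> `|u m (q j) - psi (q j)| < n.+1%:R^-1.
  move=> n; have un : (u @ \oo) [set u m | m in [set m | (n <= m)%N]].
    by exists n => // m nm; exists m.
  have n0 : 0 < n.+1%:R^-1 :> R by rewrite invr_gt0.
  have [_ [[m nm <-] um]] := clpsi _ _ un (nbhk n _ n0).
  by exists m.
exists k, psi; split.
- by move=> n; have [] := kP n.
- move=> x; apply/cvgrPdist_lt => e e0; have [r r0 rP] := psiuc _ e0.
  near=> y; apply: rP; near: y.
  exact: (@cvgr_dist_lt _ _ _ _ _ id x cvg_id).
move=> x; apply/cvgrPdist_lt => e e0; have e30 : 0 < e / 3 by rewrite divr_gt0.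
have [r1 r10 r1P] := uc _ e30; have [r2 r20 r2P] := psiuc _ e30.
(* A rational within both moduli of [x] carries the convergence at [ratr z] over to [x]. *)
have [z] : exists z, ratr z \in `]x - Num.min r1 r2, x[.
  by apply: rat_in_itvoo; rewrite ltrBlDr ltrDl lt_min r10.
rewrite in_itv /= ltrBlDr -ltrBlDl lt_min => /andP[/andP[zr1 zr2] zx].
have qz : q (pickle z) = ratr z by rewrite /q pickleK.
near=> n; have [nk kn] := kP n.
have zn : (pickle z < n)%N by near: n; exact: nbhs_infty_gt.
have ne : n.+1%:R^-1 < e / 3 by near: n; exact: near_infty_natSinv_lt (PosNum e30).
have d1 := lt_trans (kn _ zn) ne; rewrite qz in d1.
have d2 : `|psi x - psi (ratr z)| < e / 3.
  by apply: r2P; rewrite gtr0_norm ?subr_gt0//; lra.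
have d3 : `|u (k n) (ratr z) - u (k n) x| < e / 3.
  apply: r1P; rewrite (_ : _ - _ = - (x - ratr z)); last by ring.
  by rewrite normrN gtr0_norm ?subr_gt0//; lra.
rewrite -[phi _]/(u (k n) x) (_ : psi x - u (k n) x = (psi x - psi (ratr z))
  - (u (k n) (ratr z) - psi (ratr z)) + (u (k n) (ratr z) - u (k n) x)); last by ring.
rewrite (le_lt_trans (ler_normD _ _))// (_ : e = e / 3 + e / 3 + e / 3); last by field.
by rewrite ltrD// (le_lt_trans (ler_normB _ _))// ltrD.
Unshelve. all: by end_near. Qed.

(** * Equation (E) as an integral over the product, and uniform continuity of bounded solutions *)

Section equation.
Context {R : realType} {d : measure_display} {X : measurableType d}.
Context (mu : {finite_measure set X -> \bar R}) (K g : R -> X -> R).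
Context (K_ge0 : forall s tau, 0 <= K s tau)
  (K_meas : measurable_fun setT (fun p : R * X => K p.1 p.2))
  (g_meas : measurable_fun ((`[0%R, +oo[%classic `*` [set: X]) : set (R * X))
     (fun p : R * X => g p.1 p.2))
  (g_ge0 : forall u tau, 0 <= u -> 0 <= g u tau)
  (HC : condC mu K g).
Local Notation leb := (@lebesgue_measure R).
Local Notation P := (leb \x mu)%E.

(** Measurability of [g] is known only on [[0, +oo[], hence the sign condition on [u]. *)
Lemma measurable_g_comp (u : R * X -> R) : measurable_fun setT u -> (forall p, 0 <= u p) ->
  measurable_fun setT (fun p : R * X => g (u p) p.2).
Proof.
move=> mu_ u0.
suff : measurable_fun setT ((fun p : R * X => g p.1 p.2) \o (fun p => (u p, p.2))) by [].
apply: (measurable_comp _ _ g_meas).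
- by apply: measurableX => //; exact: measurable_itv.
- by move=> _ [p _ <-]; split => //=; rewrite in_itv /= andbT.
- by apply: measurable_fun_pair => //; exact: measurable_snd.
Qed.

Lemma measurable_reflect (phi : R -> R) (t : R) : continuous phi ->
  measurable_fun setT (fun p : R * X => phi (t - p.1)).
Proof.
move=> cphi; apply: (measurableT_comp (continuous_measurable_fun cphi)).
exact: (measurable_funB (measurable_cst t) measurable_fst).
Qed.

Lemma measurable_integrand (phi : R -> R) (t : R) : continuous phi -> (forall t, 0 <= phi t) ->
  measurable_fun setT (fun p : R * X => K p.1 p.2 * g (phi (t - p.1)) p.2).
Proof.
move=> cphi phi0; apply: measurable_funM => //.
by apply: measurable_g_comp => //; exact: measurable_reflect.
Qed.

(** Tonelli's theorem; with a single integral over the product, shifts, dominated convergence and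
    Fatou's lemma apply directly. *)
Lemma rhsE_prod (phi : R -> R) (t : R) : continuous phi -> (forall t, 0 <= phi t) ->
  (rhsE mu K g phi t = \int[P]_p (K p.1 p.2 * g (phi (t - p.1)) p.2)%:E)%E.
Proof.
move=> cphi phi0; apply/esym.
apply: (@fubini_tonelli2 _ _ _ _ _ leb mu
  (fun p => (K p.1 p.2 * g (phi (t - p.1)) p.2)%:E)).
  by apply/measurable_EFinP; exact: measurable_integrand.
by move=> p; rewrite lee_fin mulr_ge0// g_ge0.
Qed.

(** Condition (C) recast by Tonelli: [C * K] is the integrable majorant used in every limit passage
    on solutions except Fatou's. *)
Lemma condC_prod (M : R) : 0 < M -> exists C : X -> R,
  [/\ measurable_fun setT C, forall tau, 0 <= C tau,
     forall u tau, 0 <= u <= M -> g u tau <= C tau * u &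
     P.-integrable setT (EFin \o (fun p : R * X => C p.2 * K p.1 p.2))].
Proof.
move=> M0; have [C [mC [C0 [gC CK]]]] := HC M M0; exists C; split => //.
have mCK : measurable_fun setT (fun p : R * X => C p.2 * K p.1 p.2).
  by apply: measurable_funM => //; exact: (measurableT_comp mC measurable_snd).
have mECK : measurable_fun setT (EFin \o (fun p : R * X => C p.2 * K p.1 p.2)).
  exact/measurable_EFinP.
have CK0 (p : R * X) : (0 <= (C p.2 * K p.1 p.2)%:E)%E by rewrite lee_fin mulr_ge0.
apply/integrableP; split => //.
under eq_integral do rewrite gee0_abs//=.
rewrite (@fubini_tonelli2 _ _ _ _ _ leb mu _ mECK CK0).
apply: le_lt_trans CK; rewrite le_eqVlt; apply/orP; left; apply/eqP.
apply: eq_integral => tau _; rewrite /fubini_G /=.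
under eq_integral do rewrite EFinM.
rewrite ge0_integralZl_EFin//.
- by move=> s _; rewrite lee_fin.
- by apply/measurable_EFinP; exact: (measurableT_comp K_meas (measurable_pair2 tau)).
Qed.

(** The bound does not depend on [t], so L^1-continuity of translations of [C * K] yields a uniform
    modulus of continuity. *)
Lemma solution_increment (phi : R -> R) (M : R) (C : X -> R) (t a : R) :
  is_solution mu K g phi -> 0 <= M -> (forall t, phi t <= M) -> measurable_fun setT C ->
  (forall tau, 0 <= C tau) ->
  (forall u tau, 0 <= u <= M -> g u tau <= C tau * u) ->
  (`|phi (t + a) - phi t|%:E <= M%:E *
    \int[P]_p `|(C p.2 * K (p.1 + a) p.2 - C p.2 * K p.1 p.2)%:E|)%E.
Proof.
move=> [cphi [phi0 phiE]] M0 phiM mC C0 gC.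
(* The shift is moved onto K, so that g (phi (t - s)) tau <= C tau * M is a common factor. *)
pose G (p : R * X) := g (phi (t - p.1)) p.2.
have mG : measurable_fun setT G by apply: measurable_g_comp => //; exact: measurable_reflect.
have G0 p : 0 <= G p by exact: g_ge0.
have GC p : G p <= C p.2 * M.
  by rewrite (le_trans (gC _ _ _)) ?phi0 ?phiM// ler_wpM2l.
have mKa : measurable_fun setT (fun p : R * X => K (p.1 + a) p.2).
  exact: (measurable_prod_shift (fun p => K p.1 p.2) a K_meas).
have phitE : ((phi t)%:E = \int[P]_p (K p.1 p.2 * G p)%:E)%E.
  by rewrite phiE rhsE_prod.
have phitaE : ((phi (t + a))%:E = \int[P]_p (K (p.1 + a) p.2 * G p)%:E)%E.
  rewrite phiE rhsE_prod// -(ge0_integral_prod_shift _ _ a).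
  - apply: eq_integral => p _ /=; rewrite /G.
    by have -> : t + a - (p.1 + a) = t - p.1 by ring.
  - by apply/measurable_EFinP; exact: measurable_integrand.
  - by move=> p; rewrite lee_fin mulr_ge0// g_ge0.
have mKG : measurable_fun setT (fun p : R * X => (K p.1 p.2 * G p)%:E).
  by apply/measurable_EFinP; exact: measurable_funM.
have mKaG : measurable_fun setT (fun p : R * X => (K (p.1 + a) p.2 * G p)%:E).
  by apply/measurable_EFinP; exact: measurable_funM.
pose D (p : R * X) : \bar R := `|(C p.2 * K (p.1 + a) p.2 - C p.2 * K p.1 p.2)%:E|%E.
have mC2 : measurable_fun setT (fun p : R * X => C p.2).
  exact: (measurableT_comp mC measurable_snd).
have mD : measurable_fun setT D.
  by apply/measurableT_comp => //; apply/measurable_EFinP/measurable_funB; exact: measurable_funM.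
have D0 p : (0 <= D p)%E by exact: abse_ge0.
have KG0 (p : R * X) : (0 <= (K p.1 p.2 * G p)%:E)%E by rewrite lee_fin mulr_ge0.
have KaG0 (p : R * X) : (0 <= (K (p.1 + a) p.2 * G p)%:E)%E by rewrite lee_fin mulr_ge0.
have MD0 p : (0 <= M%:E * D p)%E by rewrite mule_ge0.
have mMD : measurable_fun setT (fun p => M%:E * D p)%E by exact: measurable_funeM.
have DE p : (M%:E * D p)%E = (`|K (p.1 + a) p.2 - K p.1 p.2| * (C p.2 * M))%:E.
  rewrite /D -mulrBr /= -EFinM; congr EFin.
  by rewrite normrM (ger0_norm (C0 _)); ring.
(* Two one-sided comparisons in additive form avoid subtracting extended-real integrals. *)
have le1 (p : R * X) : ((K (p.1 + a) p.2 * G p)%:E <= (K p.1 p.2 * G p)%:E + M%:E * D p)%E.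
  rewrite DE -EFinD lee_fin -lerBlDl -mulrBl.
  rewrite (le_trans (ler_norm _))// normrM (ger0_norm (G0 _)).
  by rewrite ler_wpM2l.
have le2 (p : R * X) : ((K p.1 p.2 * G p)%:E <= (K (p.1 + a) p.2 * G p)%:E + M%:E * D p)%E.
  rewrite DE -EFinD lee_fin -lerBlDl -mulrBl.
  rewrite (le_trans (ler_norm _))// normrM (ger0_norm (G0 _)) distrC.
  by rewrite ler_wpM2l.
rewrite -[X in (_ <= X)%E]/(M%:E * \int[P]_p D p)%E -ge0_integralZl_EFin//.
set I := (\int[P]_p _)%E.
have I1 : ((phi (t + a))%:E <= (phi t)%:E + I)%E.
  rewrite phitaE phitE /I -ge0_integralD//; apply: ge0_le_integral => //.
  exact: emeasurable_funD.
have I2 : ((phi t)%:E <= (phi (t + a))%:E + I)%E.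
  rewrite phitaE phitE /I -ge0_integralD//; apply: ge0_le_integral => //.
  exact: emeasurable_funD.
have I0 : (0 <= I)%E by exact: integral_ge0.
move: I0 I1 I2; case: I => [r||] //; last by move=> _ _ _; exact: leey.
rewrite -!EFinD !lee_fin => r0 r1 r2.
by rewrite ler_norml; apply/andP; split; lra.
Qed.

Lemma solution_unif_cont (phi : R -> R) (M : R) : 0 < M ->
  is_solution mu K g phi -> (forall t, phi t <= M) ->
  forall e, 0 < e -> exists2 r, 0 < r & forall x y, `|x - y| < r -> `|phi x - phi y| < e.
Proof.
move=> M0 sphi phiM e e0; have [C [mC C0 gC iCK]] := condC_prod _ M0.
apply: contrapT => nuc.
(* Failure of uniform continuity provides a sequence of increments [h n] tending to 0, to which the
   L^1 result applies. *)
have /choice[xy xyP] : forall n : nat, exists xy : R * R,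
    `|xy.1 - xy.2| < n.+1%:R^-1 /\ e <= `|phi xy.1 - phi xy.2|.
  move=> n; apply: contrapT => nxy; apply: nuc; exists n.+1%:R^-1; first by rewrite invr_gt0.
  move=> x y xyn; rewrite ltNge; apply/negP => exy; apply: nxy.
  by exists (x, y).
pose h n := (xy n).1 - (xy n).2.
have h1 n : `|h n| <= 1.
  by rewrite (le_trans (ltW (xyP n).1))// invf_le1// ler1n.
have h0 : h n @[n --> \oo] --> 0.
  apply/cvgr0Pnorm_lt => r r0; near=> n.
  rewrite (lt_trans (xyP n).1)//; near: n; exact: near_infty_natSinv_lt (PosNum r0).
have := integral_prod_translation_cvg0 mu h _ h1 h0 iCK.
move/ge0_cvge0P => /(_ (fun n => integral_ge0 _ (fun _ _ => abse_ge0 _))).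
(* This level makes the increment of [phi] at most [e / 2], against the lower bound [e]. *)
have eM0 : 0 < e / (2 * M) by rewrite divr_gt0// mulr_gt0.
move=> /(_ _ eM0) [n _ /(_ n (leqnn n)) /= In].
have := solution_increment _ _ _ (xy n).2 (h n) sphi (ltW M0) phiM mC C0 gC.
have -> : (xy n).2 + h n = (xy n).1 by rewrite /h; ring.
have M0' : (0 <= M%:E)%E by rewrite lee_fin ltW.
move=> /le_trans /(_ (lee_wpmul2l M0' In)).
rewrite -EFinM lee_fin.
have -> : M * (e / (2 * M)) = e / 2 by field; rewrite gt_eqF.
have := (xyP n).2; lra.
Unshelve. all: by end_near. Qed.

(** * Limits of translates of a solution *)

Context (g_cont : forall tau, {within `[0, +oo[, continuous (fun u => g u tau)}).

Lemma g_cvg (tau : X) (u : nat -> R) (l : R) : (forall n, 0 <= u n) -> 0 <= l ->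
  u n @[n --> \oo] --> l -> g (u n) tau @[n --> \oo] --> g l tau.
Proof.
move=> u0 l0 ul.
have /subspace_continuousP/(_ l) := g_cont tau.
rewrite /= in_itv /= andbT => /(_ l0) gl.
apply: cvg_comp gl => /=.
move=> A /ul H; suff : \forall n \near \oo, A (u n) by [].
have H' : \forall n \near \oo, (`[0, +oo[%classic (u n) -> A (u n)) := H.
apply: filterS H' => n; apply; rewrite /= in_itv /= andbT; exact: u0.
Qed.

(** Each translate solves (E); dominated convergence with majorant [M * C * K] passes to the limit
    on the right-hand side. *)
Lemma translates_limit_solution (phi psi : R -> R) (t : nat -> R) (M : R) : 0 < M ->
  is_solution mu K g phi -> (forall x, phi x <= M) -> continuous psi ->
  (forall x, phi (t n + x) @[n --> \oo] --> psi x) -> is_solution mu K g psi.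
Proof.
move=> M0 [cphi [phi0 phiE]] phiM cpsi phipsi.
have psi0 x : 0 <= psi x.
  by apply: (cvgr_to_ge (phipsi x)); apply: nearW => n; exact: phi0.
split => //; split => // x; rewrite rhsE_prod//.
have [C [mC C0 gC iCK]] := condC_prod _ M0.
have [] := @dominated_convergence _ _ _ P setT measurableT
  (fun n p => (K p.1 p.2 * g (phi (t n + x - p.1)) p.2)%:E)
  (fun p => (K p.1 p.2 * g (psi (x - p.1)) p.2)%:E)
  (fun p => M%:E * (C p.2 * K p.1 p.2)%:E)%E.
- by move=> n; apply/measurable_EFinP; exact: measurable_integrand.
- by apply/measurable_EFinP; exact: measurable_integrand.
- apply: aeW => p _; apply: cvg_EFin; first exact: nearW.
  rewrite /comp /=; apply: cvgM; first exact: cvg_cst.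
  apply: g_cvg => //; under eq_fun do rewrite -addrA; exact: phipsi.
- exact: integrableZl.
- apply: aeW => p n _; rewrite /= lee_fin ger0_norm; last by rewrite mulr_ge0// g_ge0.
  rewrite (_ : M * (C p.2 * K p.1 p.2) = K p.1 p.2 * (C p.2 * M)); last by ring.
  rewrite ler_wpM2l//.
  have := gC (phi (t n + x - p.1)) p.2; rewrite phi0 phiM => /(_ isT) /le_trans; apply.
  by rewrite ler_wpM2l.
move=> _ _ H; apply: (cvg_unique _ _ H) => //.
rewrite (_ : (fun _ => _) = (fun n => (phi (t n + x))%:E)).
  by apply: cvg_EFin; [exact: nearW|exact: phipsi].
by apply/funext => n; rewrite phiE rhsE_prod.
Qed.

(** * Propagation of smallness through condition (P) *)

Context (HP : condP mu K g).

(** Otherwise points [t n] with [phi (t n)] tending to 0 and [phi (t n + s) >= e] would give a limit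
    solution that vanishes at 0 but is at least [e] at [s], against (P). *)
Lemma small_translate (phi : R -> R) (M : R) : 0 < M ->
  is_solution mu K g phi -> (forall t, phi t <= M) ->
  forall s e, 0 < e -> exists2 eta, 0 < eta & forall t, phi t < eta -> phi (t + s) < e.
Proof.
move=> M0 sphi phiM s e e0; have [_ [phi0 _]] := sphi.
apply: contrapT => neta.
have /choice[t tP] : forall n : nat, exists t, phi t < n.+1%:R^-1 /\ e <= phi (t + s).
  move=> n; apply: contrapT => nt; apply: neta; exists n.+1%:R^-1; first by rewrite invr_gt0.
  by move=> t tn; rewrite ltNge; apply/negP => et; apply: nt; exists t.
have [|k [psi [kn cpsi phipsi]]] 
    := translates_cluster _ phi M t _ (solution_unif_cont _ _ M0 sphi phiM).
  by move=> x; rewrite phi0 phiM.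
have spsi : is_solution mu K g psi.
  exact: (translates_limit_solution phi psi (t \o k) M).
have psiM x : psi x <= M.
  by apply: (cvgr_to_le (phipsi x)); apply: nearW => n; exact: phiM.
have bpsi : bounded_fun psi.
  exists M; split; first exact: num_real.
  by move=> y My x _ /=; rewrite ger0_norm; [exact: (le_trans (psiM x) (ltW My))|exact: spsi.2.1].
have psi00 : psi 0 = 0.
  apply/eqP; rewrite eq_le spsi.2.1 andbT; apply/ler_addgt0Pl => r r0; rewrite addr0.
  apply: (cvgr_to_le (phipsi 0)); near=> n; rewrite addr0 (le_trans (ltW (tP _).1))//.
  (* The bound at index [k n] is compared with the one at [n] through [n <= k n]. *)
  rewrite (@le_trans _ _ n.+1%:R^-1)//.
    by rewrite lef_pV2 ?posrE// ler_nat ltnS.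
  apply: ltW; near: n; exact: near_infty_natSinv_lt (PosNum r0).
have psis0 : psi s = 0 by apply: (HP _ spsi bpsi); exists 0.
have : e <= psi s.
  by apply: (cvgr_to_ge (phipsi s)); apply: nearW => n; exact: (tP _).2.
by rewrite psis0 leNgt e0.
Unshelve. all: by end_near. Qed.

(** Smallness at finitely many offsets spaced by [r / 2] controls a whole window, since [phi] varies
    by less than [e / 2] over distances below [r]. The induction enlarges the window by [r / 2] on
    each side. *)
Lemma small_window (phi : R -> R) (M : R) : 0 < M ->
  is_solution mu K g phi -> (forall t, phi t <= M) ->
  forall L e, 0 < e ->
  exists2 eta, 0 < eta & forall t s, phi t < eta -> `|s| <= L -> phi (t + s) < e.
Proof.
move=> M0 sphi phiM L e e0.
have e20 : 0 < e / 2 by rewrite divr_gt0.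
have [r r0 rP] := solution_unif_cont _ _ M0 sphi phiM _ e20.
have st := small_translate _ _ M0 sphi phiM.
have H : forall k : nat, exists2 eta, 0 < eta &
    forall t s, phi t < eta -> `|s| <= k%:R * (r / 2) -> phi (t + s) < e.
  elim=> [|k [eta eta0 IH]].
    by exists e => // t s; rewrite mul0r normr_le0 => ? /eqP ->; rewrite addr0.
  have [e1 e10 e1P] := st (k%:R * (r / 2)) _ e20.
  have [e2 e20' e2P] := st (- (k%:R * (r / 2))) _ e20.
  exists (Num.min eta (Num.min e1 e2)); first by rewrite !lt_min eta0 e10.
  move=> t s; rewrite !lt_min => /and3P[t1 t2 t3].
  rewrite -natr1 mulrDl mul1r => sk.
  have [|ks] := leP `|s| (k%:R * (r / 2)); first exact: IH.
  have close s0 : phi (t + s0) < e / 2 -> `|s - s0| < r -> phi (t + s) < e.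
    move=> ts0 ss0; have := rP (t + s) (t + s0).
    rewrite (_ : t + s - (t + s0) = s - s0); last by ring.
    by move=> /(_ ss0); rewrite ltr_norml => /andP[]; lra.
  have [s0|s0] := leP 0 s.
    apply: (close (k%:R * (r / 2))); first exact: e1P.
    by move: sk ks; rewrite ger0_norm// ltr_norml => ? ?; apply/andP; split; lra.
  apply: (close (- (k%:R * (r / 2)))); first exact: e2P.
  by move: sk ks; rewrite ltr0_norm// ltr_norml => ? ?; apply/andP; split; lra.
have r20 : 0 < r / 2 by rewrite divr_gt0.
(* The number of half-steps [r / 2] needed to cover the length [L]. *)
have [eta eta0 etaP] := H (Num.Def.archi_bound (`|L| / (r / 2))).
exists eta => // t s teta sL; apply: etaP => //.
rewrite (le_trans sL)// (le_trans (ler_norm _))// -ler_pdivrMr//.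
by apply/ltW/archi_boundP; rewrite divr_ge0// ltW.
Qed.

(** * Linearisation at zero and the contradiction with the sign of the characteristic function *)

Context (g'0 : X -> R).
Context (g_0 : forall tau, g 0 tau = 0)
  (g_deriv : forall tau, (fun h => (g h tau - g 0 tau) / h) @ 0^'+ --> g'0 tau)
  (g_deriv_pos : forall tau, 0 < g'0 tau).

Lemma chi0_integral_le1 (phi : R -> R) (M : R) (m : nat -> R) : 0 < M ->
  is_solution mu K g phi -> (forall t, phi t <= M) ->
  (forall t, 0 < phi t) -> phi (m n) @[n --> \oo] --> 0 ->
  (forall n s, `|s| <= n%:R -> phi (m n) <= phi (m n + s)) ->
  (chi0_integral mu K g'0 <= 1)%E.
Proof.
move=> M0 sphi phiM phipos m0 mmin; have [cphi [phi0 phiE]] := sphi.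
(* Dividing by the maximum keeps the quotient below the integrand over [phi (m n)] for every
   s; for n >= |s| the maximum is u := phi (m n - s), and g u tau / u -> g'0 tau as u -> 0. *)
pose mx n s := Num.max (phi (m n - s)) (phi (m n)).
have mx0 n s : 0 < mx n s by rewrite lt_max phipos.
pose h n (p : R * X) := K p.1 p.2 * g (phi (m n - p.1)) p.2 * (mx n p.1)^-1.
have mh n : measurable_fun setT (h n).
  apply: measurable_funM; first exact: measurable_integrand.
  suff mv : measurable_fun [set: R] (fun s => (mx n s)^-1).
    exact: (measurableT_comp mv measurable_fst).
  apply: continuous_measurable_fun => s.
  apply: cvgV; first by rewrite gt_eqF.
  apply: continuous_max; last exact: cst_continuous.
  apply: (@continuous_comp _ _ _ (fun s => m n - s) phi); last exact: cphi.
  by apply: cvgB; [exact: cvg_cst|exact: cvg_id].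
have h0 n p : 0 <= h n p.
  by rewrite /h !mulr_ge0 ?invr_ge0 ?(ltW (mx0 _ _))// g_ge0.
have hcvg p : h n p @[n --> \oo] --> K p.1 p.2 * g'0 p.2.
  pose x n := phi (m n - p.1).
  have x0 : x n @[n --> \oo] --> 0.
    apply/cvgr0Pnorm_lt => e e0.
    (* For fixed [s], the value at [m n - s] also tends to 0, so the difference quotient of [g] can
       be evaluated along it; positivity of [phi] keeps it to the right of 0. *)
    have [eta eta0 etaP] := small_translate _ _ M0 sphi phiM (- p.1) _ e0.
    have meta : \forall n \near \oo, `|phi (m n)| < eta.
      by move/cvgr0Pnorm_lt : m0; apply.
    apply: filterS meta => n; rewrite !ger0_norm//; last exact: phi0.
    exact: etaP.
  have /cvg_at_rightP/(_ x) := g_deriv p.2.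
  move=> /(_ (conj (fun n => phipos _) x0)) gx.
  have : K p.1 p.2 * ((g (x n) p.2 - g 0 p.2) / x n) @[n --> \oo] --> K p.1 p.2 * g'0 p.2.
    by apply: cvgM => //; exact: cvg_cst.
  apply: cvg_trans; apply: near_eq_cvg; near=> n.
  rewrite /h g_0 subr0 mulrA; congr (_ * _^-1); rewrite /mx /x.
  apply/esym/max_idPl; apply: mmin; rewrite normrN; near: n.
  exact: nbhs_infty_ger.
(* Measurability of the limit integrand comes from its being a pointwise limit of the [h n]. *)
have mlim : measurable_fun setT (fun p : R * X => (K p.1 p.2 * g'0 p.2)%:E).
  apply: (emeasurable_fun_cvg (fun n p => (h n p)%:E)).
    by move=> n; exact/measurable_EFinP.
  by move=> p _; apply: cvg_EFin; [exact: nearW|exact: hcvg].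
have -> : chi0_integral mu K g'0 = (\int[P]_p (K p.1 p.2 * g'0 p.2)%:E)%E.
  apply/esym; apply: (@fubini_tonelli2 _ _ _ _ _ leb mu
    (fun p => (K p.1 p.2 * g'0 p.2)%:E) mlim).
  by move=> p; rewrite lee_fin mulr_ge0// ltW.
have -> : (\int[P]_p (K p.1 p.2 * g'0 p.2)%:E =
    \int[P]_p limn_einf (fun n => (h n p)%:E))%E.
  apply: eq_integral => p _; apply/esym.
  apply: (cvg_limn_einf_sup _).1; apply: cvg_EFin; [exact: nearW|exact: hcvg].
have mhE n : measurable_fun setT (fun p => (h n p)%:E) by exact/measurable_EFinP.
have h0E n (p : R * X) : setT p -> (0 <= (h n p)%:E)%E by rewrite lee_fin.
apply: (le_trans (@fatou _ _ _ P setT measurableT (fun n p => (h n p)%:E) mhE h0E)).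
have hint n : (\int[P]_p (h n p)%:E <= 1)%E.
  have phim0 : 0 <= (phi (m n))^-1 by rewrite invr_ge0.
  have mint : measurable_fun setT (fun p : R * X => (K p.1 p.2 * g (phi (m n - p.1)) p.2)%:E).
    by apply/measurable_EFinP; exact: measurable_integrand.
  have int0 (p : R * X) : (0 <= (K p.1 p.2 * g (phi (m n - p.1)) p.2)%:E)%E.
    by rewrite lee_fin mulr_ge0// g_ge0.
  apply: (@le_trans _ _ (\int[P]_p ((phi (m n))^-1%:E *
      (K p.1 p.2 * g (phi (m n - p.1)) p.2)%:E))%E).
    apply: ge0_le_integral.
    - exact: measurableT.
    - by move=> p _; rewrite lee_fin.
    - exact: mhE.
    - exact: measurable_funeM.
    - move=> p _; rewrite -EFinM lee_fin /h mulrC ler_wpM2r//.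
        by rewrite -lee_fin.
      by rewrite lef_pV2 ?posrE// le_max lexx orbT.
  rewrite ge0_integralZl_EFin// -rhsE_prod// -phiE -EFinM mulVf// gt_eqF//.
(* Every eventual set contains some index [N], so the infimum over it is at most the [N]-th
   integral, hence at most 1. *)
rewrite /limn_einf /limn_esup -/(limf_einf _ _) limf_einfE.
apply: ge_ereal_sup => _ [V [N _ NV] <-].
apply: le_trans (hint N); apply: ereal_inf_lbound; exists N => //.
exact/NV/leqnn.
Unshelve. all: by end_near. Qed.

Lemma no_deep_dips (phi : R -> R) (M delta : R) : 0 < M ->
  is_solution mu K g phi -> (forall t, phi t <= M) ->
  (1 < chi0_integral mu K g'0)%E -> 0 < delta ->
  ~ (forall eta, 0 < eta -> exists a t b : R,
       [/\ a < t < b, delta <= phi a, delta <= phi b & phi t < eta]).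
Proof.
move=> M0 sphi phiM chi1 delta0 dips; have [cphi [phi0 _]] := sphi.
(* A zero of [phi] would make it vanish identically by (P), whereas a dip has ends of height at
   least [delta]. *)
have phipos t : 0 < phi t.
  rewrite lt_neqAle phi0 andbT eq_sym; apply/negP => /eqP phit.
  have bphi : bounded_fun phi.
    exists M; split; first exact: num_real.
    by move=> y My x _ /=; rewrite ger0_norm//; exact: (le_trans (phiM x) (ltW My)).
  have [a [? [? [_ + _ _]]]] := dips _ ltr01.
  by rewrite (HP _ sphi bphi) ?leNgt ?delta0//; exists t.
have /choice[m mP] : forall n : nat, exists m, phi m < n.+1%:R^-1 /\
    forall s, `|s| <= n%:R -> phi m <= phi (m + s).
  move=> n; have [eta eta0 etaP] := small_window _ _ M0 sphi phiM n%:R _ delta0.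
  have [|a [t [b [/andP[at_ tb] da db]]]] := dips (Num.min eta n.+1%:R^-1).
    by rewrite lt_min eta0 invr_gt0/=.
  rewrite lt_min => /andP[teta tn].
  (* The minimiser over [[a, b]] is at least as low as the dip, so the window of radius [n] around
     it stays below [delta]. *)
  have [c cab cmin] := EVT_min (ltW (lt_trans at_ tb)) (continuous_subspaceT cphi).
  have ct : phi c <= phi t by apply: cmin; rewrite in_itv /= !ltW.
  move: cab; rewrite in_itv /= => /andP[ac cb].
  exists c; split; first exact: le_lt_trans tn.
  have far s : `|s| <= n%:R -> phi (c + s) < delta.
    by apply: etaP; exact: le_lt_trans teta.
  move=> s; rewrite ler_norml => /andP[s1 s2]; apply: cmin; rewrite in_itv /=.
  (* If the window left [[a, b]], it would contain [a] or [b], where [phi >= delta]. *)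
  apply/andP; split; rewrite leNgt; apply/negP => cs.
    have := far (a - c); rewrite (addrC c) subrK ltNge da ler_norml => H.
    suff : false by []; apply: H; apply/andP; split; lra.
  have := far (b - c); rewrite (addrC c) subrK ltNge db ler_norml => H.
  suff : false by []; apply: H; apply/andP; split; lra.
have m0 : phi (m n) @[n --> \oo] --> 0.
  apply/cvgr0Pnorm_lt => r r0; near=> n; rewrite ger0_norm//.
  rewrite (lt_trans (mP n).1)//; near: n; exact: near_infty_natSinv_lt (PosNum r0).
have := chi0_integral_le1 _ _ m M0 sphi phiM phipos m0 (fun n => (mP n).2).
by rewrite leNgt chi1.
Unshelve. all: by end_near. Qed.

End equation.

(** * Negations of the two alternatives along a filter *)

Lemma limf_einf_gt0 (R : realType) (phi : R -> R) (F : set_system R) (V : set R) (e : R) :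
  0 < e -> F V -> (forall t, V t -> e <= phi t) ->
  (0 < limf_einf (fun t => (phi t)%:E) F)%E.
Proof.
move=> e0 FV eV; apply: (@lt_le_trans _ _ e%:E); first by rewrite lte_fin.
rewrite limf_einfE; apply: (@le_trans _ _ (ereal_inf [set (phi t)%:E | t in V])).
  by apply: le_ereal_inf_tmp => _ [t Vt <-]; rewrite lee_fin; exact: eV.
by apply: ereal_sup_ubound; exists V.
Qed.

(** A general [F] lets the same statement serve both ends of the line. *)
Lemma limf_einf_gt0_or_frequently_small (R : realType) (phi : R -> R) (F : set_system R) :
  (0 < limf_einf (fun t => (phi t)%:E) F)%E \/
  (forall V, F V -> forall e, 0 < e -> exists2 t, V t & phi t < e).
Proof.
have [|H] := pselect (0 < limf_einf (fun t => (phi t)%:E) F)%E; [by left|right].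
move=> V FV e e0; apply: contrapT => ne; apply: H.
apply: (limf_einf_gt0 _ phi F V e) => // t Vt; rewrite leNgt; apply/negP => te.
by apply: ne; exists t.
Qed.

Lemma cvg0_or_frequently_large (R : realType) (phi : R -> R) (F : set_system R) :
  Filter F -> (forall t, 0 <= phi t) ->
  phi t @[t --> F] --> 0 \/
  exists2 e, 0 < e & forall V, F V -> exists2 t, V t & e <= phi t.
Proof.
move=> FF phi0; have [|H] := pselect (phi t @[t --> F] --> 0); [by left|right].
apply: contrapT => ne; apply: H; apply/cvgr0Pnorm_lt => e e0.
apply: contrapT => Fe; apply: ne; exists e => // V FV; apply: contrapT => nt.
apply: Fe; apply: filterS FV => t Vt; rewrite ger0_norm// ltNge; apply/negP => et.
by apply: nt; exists t.
Qed.

Theorem theorem1p3 (R : realType) (d : measure_display) (X : measurableType d)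
  (mu : {finite_measure set X -> \bar R}) (K : R -> X -> R) (g : R -> X -> R)
  (g'0 : X -> R)
  (* hypotheses on K *)
  (K_ge0 : forall s tau, 0 <= K s tau)
  (K_meas : measurable_fun setT (fun p : R * X => K p.1 p.2))
  (K_int : (lebesgue_measure \x mu)%E.-integrable setT (fun p : R * X => (K p.1 p.2)%:E))
  (K_pos : forall tau, (0 < \int[lebesgue_measure]_s (K s tau)%:E)%E)
  (* hypotheses on g (defined on [0,+oo) x X) *)
  (g_meas : measurable_fun ((`[0%R, +oo[%classic `*` [set: X]) : set (R * X)) (fun p : R * X => g p.1 p.2))
  (g_ge0 : forall u tau, 0 <= u -> 0 <= g u tau)
  (g_0 : forall tau, g 0 tau = 0)
  (g_cont : forall tau, {within `[0, +oo[, continuous (fun u => g u tau)})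
  (g_deriv : forall tau, (fun h => (g h tau - g 0 tau) / h) @ 0^'+ --> g'0 tau)
  (g_deriv_pos : forall tau, 0 < g'0 tau)
  (HC : condC mu K g) (HP : condP mu K g)
  (* chi(0) = 1 - chi0_integral is defined (the integral converges) and < 0 *)
  (Hchi_fin : (chi0_integral mu K g'0 < +oo)%E)
  (Hchi : (1%:E - chi0_integral mu K g'0 < 0)%E)
  (phi : R -> R) (Hphi : is_solution mu K g phi) (Hbd : bounded_fun phi) :
  ((0 < limf_einf (fun t => (phi t)%:E) (pinfty_nbhs R))%E
     \/ phi t @[t --> +oo] --> 0)
  /\
  ((0 < limf_einf (fun t => (phi t)%:E) (ninfty_nbhs R))%E
     \/ phi t @[t --> -oo] --> 0).
Proof.
have [cphi [phi0 _]] := Hphi.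
have [M [M0 phiM]] : exists M, 0 < M /\ forall t, phi t <= M.
  have [M [_ HM]] := Hbd; exists (`|M| + 1); split; first by rewrite ltr_wpDl.
  move=> t; rewrite (le_trans (ler_norm _))//.
  by apply: HM => //; rewrite (le_lt_trans (ler_norm M))// ltrDl.
(* Finiteness of the integral turns the extended-real inequality into one between reals. *)
have chi1 : (1 < chi0_integral mu K g'0)%E.
  move: Hchi Hchi_fin; case: (chi0_integral _ _ _) => [r||]//.
  by rewrite -EFinB !lte_fin subr_lt0.
have nodips delta := no_deep_dips mu K g K_ge0 K_meas g_meas g_ge0 HC g_cont HP
  g'0 g_0 g_deriv g_deriv_pos phi M delta M0 Hphi phiM chi1.
split.
- have [|small] := limf_einf_gt0_or_frequently_small _ phi (pinfty_nbhs R); first by left.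
  have [|[delta delta0 large]] := cvg0_or_frequently_large _ phi (pinfty_nbhs R) _ phi0.
    by right.
  exfalso; apply: (nodips delta delta0) => eta eta0.
  have gtF (x : R) : pinfty_nbhs R [set t | x < t].
    by exists x; split => //; exact: num_real.
  (* The points are picked from left to right, each beyond the previous one; the starting threshold
     0 is arbitrary. *)
  have [a _ da] := large _ (gtF 0).
  have [t at_ teta] := small _ (gtF a) _ eta0.
  have [b tb db] := large _ (gtF t).
  by exists a, t, b; split => //; rewrite at_.
- have [|small] := limf_einf_gt0_or_frequently_small _ phi (ninfty_nbhs R); first by left.
  have [|[delta delta0 large]] := cvg0_or_frequently_large _ phi (ninfty_nbhs R) _ phi0.
    by right.
  exfalso; apply: (nodips delta delta0) => eta eta0.
  have ltF (x : R) : ninfty_nbhs R [set t | t < x].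
    by exists x; split => //; exact: num_real.
  (* At the other end the order of choice is reversed: [b] first, then [t] and [a] further to the
     left. *)
  have [b _ db] := large _ (ltF 0).
  have [t tb teta] := small _ (ltF b) _ eta0.
  have [a at_ da] := large _ (ltF t).
  by exists a, t, b; split => //; rewrite at_.
Qed.
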